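(* Let $f,g\colon X\to Y$ be continuous maps and let $u=u_0\smile\cdots\smile u_k$ be a cup product of cohomology classes $u_0,\dots,u_k\in\mathcal{J}(f,g)$. Then $\mathrm{hw}(u)\geq \sum_{j=0}^k \mathrm{hw}(u_j)$, where $\mathrm{hw}=\mathrm{hw}_{f,g}$.
   Context: $R$ is a commutative ring with unit and $H^*(-;R)$ is cohomology with coefficients in $R$; $\mathcal{J}(f,g)\subset H^*(X;R)$ is the image of $f^*-g^*\colon H^*(Y;R)\to H^*(X;R)$. For continuous maps $f,g\colon X\to Y$, the homotopic distance $\mathrm{D}(f,g)$ is the least integer $n\geq 0$ such that there is an open cover $\{U_0,\dots,U_n\}$ of $X$ with $f|_{U_j}\simeq g|_{U_j}$ for all $j$ ($\infty$ if none exists). Homotopy weight: for $u\in H^*(X;R)$, $\mathrm{hw}_{f,g}(u)=k+1$ where $k$ is the greatest integer such that for every topological space $A$ and every continuous map $\phi\colon A\to X$ with $\mathrm{D}(f\circ\phi,g\circ\phi)\leq k$ one has $\phi^*u=0\in H^*(A;R)$; and $\mathrm{hw}_{f,g}(0)=\infty$. *)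

(* Defs.v *)
From HB Require Import structures.
From mathcomp Require Import all_boot all_order all_algebra.
From mathcomp Require Import all_classical all_reals all_analysis.
From mathcomp Require Import Rstruct Rstruct_topology.

Set Implicit Arguments.
Unset Strict Implicit.
Unset Printing Implicit Defensive.

Import Order.TTheory GRing.Theory Num.Theory.
Local Open Scope classical_set_scope.
Local Open Scope ring_scope.

Notation RR := Rdefinitions.R.

Definition std_simplex (n : nat) : set 'rV[RR]_(n.+1) :=
  [set x | (forall i, 0 <= x ord0 i) /\ \sum_(i < n.+1) x ord0 i = 1].
Arguments std_simplex n : clear implicits.

(** A singular n-simplex in X is a map 'rV_(n+1) -> X continuous on the
    standard simplex; its values outside the simplex are irrelevant. *)
Definition singular (X : topologicalType) (n : nat) (s : 'rV[RR]_(n.+1) -> X) :=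
  {within std_simplex n, continuous s}.

(** n-cochains (meaningful on singular simplices only). *)
Definition cochain (K : comPzRingType) (X : topologicalType) (n : nat) :=
  ('rV[RR]_(n.+1) -> X) -> K.

Definition wd_cochain (K : comPzRingType) (X : topologicalType) (n : nat)
  (phi : cochain K X n) :=
  forall s t, singular s -> singular t ->
    {in std_simplex n, s =1 t} -> phi s = phi t.

Definition face (n : nat) (i : 'I_(n.+2)) (x : 'rV[RR]_(n.+1)) : 'rV[RR]_(n.+2) :=
  \row_(j < n.+2) (match unlift i j with Some j' => x ord0 j' | None => 0 end).

Definition cobound (K : comPzRingType) (X : topologicalType) (n : nat)
  (phi : cochain K X n) : cochain K X n.+1 :=
  fun s => \sum_(i < n.+2) (-1) ^+ i * phi (s \o face i).

Definition cocycle (K : comPzRingType) (X : topologicalType) (n : nat)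
  (phi : cochain K X n) :=
  forall s, singular s -> cobound phi s = 0.

Definition cohomologous (K : comPzRingType) (X : topologicalType) (n : nat) :
  cochain K X n -> cochain K X n -> Prop :=
  match n with
  | 0 => fun phi psi => forall s, singular s -> phi s = psi s
  | m.+1 => fun phi psi => exists eta : cochain K X m, wd_cochain eta /\
      forall s, singular s -> phi s - psi s = cobound eta s
  end.

Definition gcochain (K : comPzRingType) (X : topologicalType) :=
  forall n : nat, cochain K X n.

Definition gzero (K : comPzRingType) (X : topologicalType) : gcochain K X :=
  fun n s => 0.
Arguments gzero K X n s : clear implicits.

(** A graded cochain representing an element of H^*(X;K) = (+)_n H^n(X;K):
    well-defined cocycles in every degree, cohomologous to 0 in all
    large enough degrees. *)
Definition gclass (K : comPzRingType) (X : topologicalType) (u : gcochain K X) :=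
  (forall n, wd_cochain (u n) /\ cocycle (u n)) /\
  exists N, forall n, (N <= n)%N -> cohomologous (u n) (gzero K X n).

Definition gcohom (K : comPzRingType) (X : topologicalType) (u v : gcochain K X) :=
  forall n, cohomologous (u n) (v n).

Definition pullback (K : comPzRingType) (A X : topologicalType) (h : A -> X)
  (u : gcochain K X) : gcochain K A :=
  fun n s => u n (h \o s).
Arguments pullback {K A X} h u n s.

Definition front (n p : nat) (x : 'rV[RR]_(p.+1)) : 'rV[RR]_(n.+1) :=
  \row_(j < n.+1) (if (j <= p)%N then x ord0 (inord j) else 0).
Definition back (n p : nat) (x : 'rV[RR]_((n - p).+1)) : 'rV[RR]_(n.+1) :=
  \row_(j < n.+1) (if (p <= j)%N then x ord0 (inord (j - p)) else 0).
Arguments front n p x : clear implicits.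
Arguments back n p x : clear implicits.

Definition gcup (K : comPzRingType) (X : topologicalType) (u v : gcochain K X) :
  gcochain K X :=
  fun n s => \sum_(p < n.+1) u p (s \o front n p) * v (n - p)%N (s \o back n p).

Fixpoint gcup_iter (K : comPzRingType) (X : topologicalType) (k : nat)
  (u : nat -> gcochain K X) : gcochain K X :=
  match k with
  | 0 => u 0%N
  | k'.+1 => gcup (gcup_iter k' u) (u k)
  end.

Definition in_J (K : comPzRingType) (X Y : topologicalType) (f g : X -> Y)
  (u : gcochain K X) :=
  gclass u /\ exists w : gcochain K Y, gclass w /\
    gcohom u (fun n s => pullback f w n s - pullback g w n s).

Definition homotopic_on (X Y : topologicalType) (U : set X) (f g : X -> Y) :=
  exists H : X * RR -> Y,
    {within U `*` `[0, 1]%classic, continuous H} /\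
    forall x, U x -> H (x, 0) = f x /\ H (x, 1) = g x.

Definition hdist_cover (X Y : topologicalType) (f g : X -> Y) (n : nat) :=
  exists U : 'I_(n.+1) -> set X,
    (forall j, open (U j)) /\ (\bigcup_j U j = setT) /\
    (forall j, homotopic_on (U j) f g).

(** D(f,g) in \bar R (+oo if no such cover exists). *)
Definition hdist (X Y : topologicalType) (f g : X -> Y) : \bar RR :=
  ereal_inf [set (n%:R)%:E | n in hdist_cover f g].

Definition hw_prop (K : comPzRingType) (X Y : topologicalType) (f g : X -> Y)
  (u : gcochain K X) (k : nat) :=
  forall (A : topologicalType) (phi : A -> X), continuous phi ->
    (hdist (f \o phi) (g \o phi) <= (k%:R)%:E)%E ->
    gcohom (pullback phi u) (gzero K A).

(** hw(u) = k+1 for the greatest such k (0 if there is none, +oo if the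
    property holds for all k, in particular hw(0) = +oo). *)
Definition hw (K : comPzRingType) (X Y : topologicalType) (f g : X -> Y)
  (u : gcochain K X) : \bar RR :=
  ereal_sup ([set 0%E] `|` [set ((k.+1)%:R)%:E | k in hw_prop f g u]).

(* Main.v *)
Require Import Defs.
From HB Require Import structures.
From mathcomp Require Import all_boot all_order all_algebra.
From mathcomp Require Import all_classical all_reals all_analysis.
From mathcomp Require Import Rstruct Rstruct_topology.
From mathcomp Require Import ring.

(** The weight of [u] is the supremum of the [m] such that [phi^* u] vanishes
    for every [phi : A -> X] for which [A] is covered by [m] open sets on which
    [f phi] and [g phi] are homotopic ([m = 0] being always allowed, since then
    [A] is empty). It is enough to show that weights add under the cup product of
    two cocycles. Given a cover of [A] by [a + b] such open sets, let [V] be the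
    union of the first [a] and [W] that of the last [b]; then [phi^* u] vanishes
    on [V] and [phi^* v] vanishes on [W]. Extending primitives from [V] and [W] to
    [A] by zero, one may change [phi^* u] and [phi^* v] by coboundaries so that
    they vanish identically on the simplices lying in [V], respectively in [W].
    Their cup product then vanishes on all simplices lying in [V] or in [W], and
    such a cocycle [c] is a coboundary: if [S] is barycentric subdivision and [T]
    the chain homotopy between [S] and the identity, then [c] is the coboundary
    of the locally finite sum of the cochains [c T S^i]. *)

Set Implicit Arguments.
Unset Strict Implicit.
Unset Printing Implicit Defensive.

Import Order.TTheory GRing.Theory Num.Theory.
Local Open Scope classical_set_scope.
Local Open Scope ring_scope.

(** * Cochains on lists of vertices *)

Section ListCochains.
Variables (K : comPzRingType) (T : eqType).
Implicit Types (p q : seq T -> K) (l m : seq T).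

(* A functional on lists of vertices is an (augmented) cochain on the affine
   simplices of a space; [dseq] is its coboundary, written recursively by means
   of d(x * m) = m - x * dm for the cone x * m = x :: m. *)
Definition consf p x := fun l => p (x :: l).

Fixpoint dseq p l : K := if l is x :: l' then p l' - dseq (consf p x) l' else 0.

(** Front and back face share a vertex: either the front face is [[:: x]] and the back face is all
    of [l], or [x] is prepended to a front face of [l']. *)
Fixpoint cupseq p q l : K :=
  if l is x :: l' then p [:: x] * q l + cupseq (consf p x) q l' else 0.

Definition del i l := take i l ++ drop i.+1 l.

Lemma dseqE p l : dseq p l = \sum_(i < size l) (-1) ^+ i * p (del i l).
Proof.
elim: l p => [|x l IH] p /=; first by rewrite big_ord0.
rewrite big_ord_recl expr0 mul1r /del take0 drop1 /= IH -sumrN; congr (_ + _).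
by apply: eq_bigr => i _; rewrite exprS mulN1r mulNr.
Qed.

Lemma cupseqE p q l :
  cupseq p q l = \sum_(i < size l) p (take i.+1 l) * q (drop i l).
Proof.
elim: l p => [|x l IH] p /=; first by rewrite big_ord0.
rewrite big_ord_recl /= take0 IH; congr (_ + _).
Qed.

Lemma eq_dseq p q l :
  (forall m, (size m).+1 = size l -> {subset m <= l} -> p m = q m) ->
  dseq p l = dseq q l.
Proof.
elim: l p q => //= x l IH p q pq.
rewrite pq => // [|y my]; last by rewrite inE my orbT.
congr (_ - _); apply: IH => m sm ml; apply: pq => [|y] /=; first by rewrite -sm.
by rewrite !inE => /orP[->//|/ml ->]; rewrite orbT.
Qed.

Lemma dseqB p q l : dseq (fun m => p m - q m) l = dseq p l - dseq q l.
Proof.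
elim: l p q => [|x l IH] p q /=; first by rewrite subr0.
rewrite (IH (consf p x) (consf q x)); ring.
Qed.

Lemma dseqZ a p l : dseq (fun m => a * p m) l = a * dseq p l.
Proof.
elim: l p => [|x l IH] p /=; first by rewrite mulr0.
by rewrite (IH (consf p x)); ring.
Qed.

Lemma dseq_sum n (p : nat -> seq T -> K) l :
  dseq (fun m => \sum_(i < n) p i m) l = \sum_(i < n) dseq (p i) l.
Proof.
rewrite dseqE (eq_bigr _ (fun i _ => mulr_sumr _ _ _ _)) exchange_big /=.
by apply: eq_bigr => i _; rewrite dseqE.
Qed.

Lemma dseq_dseq p l : dseq (dseq p) l = 0.
Proof.
elim: l p => [|x l IH] p //=.
by rewrite (_ : consf _ _ = fun m => p m - dseq (consf p x) m)// dseqB IH; ring.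
Qed.

(** The sign of the Leibniz rule: a list of size [n + 1] is a simplex of dimension [n], and
    $(-1)^{n+2} = (-1)^n$. *)
Definition bar p l := (-1) ^+ (size l).+1 * p l.

Lemma cupseqBl p p' q l :
  cupseq (fun m => p m - p' m) q l = cupseq p q l - cupseq p' q l.
Proof.
elim: l p p' => [|x l IH] p p' /=; first by rewrite subr0.
rewrite (IH (consf p x) (consf p' x)); ring.
Qed.

Lemma cupseqNl p q l : cupseq (fun m => - p m) q l = - cupseq p q l.
Proof.
elim: l p => [|x l IH] p /=; first by rewrite oppr0.
rewrite (IH (consf p x)); ring.
Qed.

(* The last term comes from the augmentation: [dseq p [:: x] = p [::]]. *)
Lemma dseq_cupseq p q l : q [::] = 0 ->
  dseq (cupseq p q) l = cupseq (dseq p) q l + cupseq (bar p) (dseq q) l - p [::] * q l.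
Proof.
move=> q0; elim: l p => [|x l IH] p /=; first by rewrite q0; ring.
rewrite (_ : consf (cupseq p q) x =
  fun m => p [:: x] * consf q x m - cupseq (fun m => - consf p x m) q m); last first.
  by apply/funext => m; rewrite cupseqNl opprK.
rewrite dseqB dseqZ (_ : consf (bar p) x = fun m => - bar (consf p x) m); last first.
  by apply/funext => m; rewrite /bar /consf /= exprS mulN1r mulNr.
rewrite (_ : consf (dseq p) x = fun m => p m - dseq (consf p x) m)//.
rewrite (_ : cupseq (fun m => - consf p x m) q = fun m => -1 * cupseq (consf p x) q m).
  by rewrite dseqZ IH cupseqBl cupseqNl /bar /= /consf; ring.
by apply/funext => m; rewrite cupseqNl mulN1r.
Qed.

Lemma eq_cupseq p p' q q' l :
  (forall m, {subset m <= l} -> m != [::] -> p m = p' m) ->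
  (forall m, {subset m <= l} -> m != [::] -> q m = q' m) ->
  cupseq p q l = cupseq p' q' l.
Proof.
move=> pp qq; rewrite !cupseqE; apply: eq_bigr => i _.
have il := ltn_ord i; congr (_ * _); [apply: pp|apply: qq].
- by move=> x /mem_take.
- by rewrite -size_eq0 size_take; case: ifP => // _; rewrite -lt0n (leq_ltn_trans _ il).
- by move=> x /mem_drop.
- by rewrite -size_eq0 size_drop subn_eq0 -ltnNge.
Qed.

End ListCochains.

Lemma dseq_map (K : comPzRingType) (T T' : eqType) (h : T -> T')
    (p : seq T' -> K) l :
  dseq (p \o map h) l = dseq p (map h l).
Proof.
elim: l p => //= x l IH p; congr (_ - _).
by rewrite -IH.
Qed.

Lemma cupseq0r (K : comPzRingType) (T : eqType) (p : seq T -> K) l :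
  cupseq p (fun=> 0) l = 0.
Proof. by rewrite cupseqE big1// => i _; rewrite mulr0. Qed.

Lemma cupseq0l (K : comPzRingType) (T : eqType) (p : seq T -> K) l :
  cupseq (fun=> 0) p l = 0.
Proof. by rewrite cupseqE big1// => i _; rewrite mul0r. Qed.

Lemma dseq_bar (K : comPzRingType) (T : eqType) (p : seq T -> K) l :
  dseq (bar p) l = (-1) ^+ size l * dseq p l.
Proof. by rewrite -dseqZ; apply: eq_dseq => m mn _; rewrite /bar mn. Qed.

Lemma barK (K : comPzRingType) (T : eqType) : involutive (@bar K T).
Proof.
move=> p; apply/funext => l.
by rewrite /bar mulrA -signr_odd -expr2 sqrr_sign mul1r.
Qed.

Lemma size_del (T : eqType) i (l : seq T) : (i < size l)%N ->
  (size (del i l)).+1 = size l.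
Proof.
by move=> il; rewrite size_cat size_take il size_drop -addSn subnKC.
Qed.

Lemma map_del (T T' : eqType) (h : T -> T') i l : map h (del i l) = del i (map h l).
Proof. by rewrite /del map_cat map_take map_drop. Qed.

Lemma del_sub (T : eqType) i (l : seq T) : {subset del i l <= l}.
Proof. by move=> x; rewrite mem_cat => /orP[/mem_take|/mem_drop]. Qed.

(** * Barycentric subdivision *)

Section Barycentric.
Variables (K : comPzRingType) (E : normedModType RR).
Implicit Types (p q : seq E -> K) (l m : seq E) (C : set E).

Definition bary l : E := (size l)%:R^-1 *: \sum_(x <- l) x.

(* Duals of the chain operators v |-> b * Sd(dv) and v |-> b * (v - Td(dv)), where
   b is the barycenter of v; the index n must be the size of the list. *)
Fixpoint Sd n p l : K :=
  if n is n'.+1 then dseq (Sd n' (consf p (bary l))) l else p l.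

Fixpoint Td n p l : K :=
  if n is n'.+1 then p (bary l :: l) - dseq (Td n' (consf p (bary l))) l else 0.

Lemma SdB n p q l : Sd n (fun m => p m - q m) l = Sd n p l - Sd n q l.
Proof.
elim: n p q l => //= n IH p q l; rewrite -dseqB; apply: eq_dseq => m _ _.
exact: (IH (consf p _) (consf q _)).
Qed.

Lemma TdB n p q l : Td n (fun m => p m - q m) l = Td n p l - Td n q l.
Proof.
elim: n p q l => [|n IH] p q l /=; first by rewrite subr0.
rewrite (@eq_dseq _ _ _ (fun m => Td n (consf p (bary l)) m - Td n (consf q (bary l)) m)).
  by rewrite dseqB; ring.
move=> m _ _; exact: (IH (consf p _) (consf q _)).
Qed.

Lemma Sd0 n l : Sd n (fun=> 0) l = 0.
Proof. by have := SdB n (fun=> 0) (fun=> 0) l; rewrite !subrr. Qed.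

Lemma Td0 n l : Td n (fun=> 0) l = 0.
Proof. by have := TdB n (fun=> 0) (fun=> 0) l; rewrite !subrr. Qed.

Lemma iter_Sd0 i n l : iter i (Sd n) (fun=> 0) l = 0.
Proof.
elim: i l => //= i IH l; rewrite -[RHS](Sd0 n l); congr (Sd n _ l).
exact/funext.
Qed.

Lemma eq_Sd_size n p q l : size l = n ->
  (forall m, size m = n -> p m = q m) -> Sd n p l = Sd n q l.
Proof.
elim: n p q l => [|n IH] p q l ln pq /=; first exact: pq.
apply: eq_dseq => m; rewrite ln => -[mn] _; apply: IH => // m' m'n.
by apply: pq => /=; rewrite m'n.
Qed.

(** By the cone formula $d(b * c) = c - b * dc$ the only surplus term is [dseq (Sd n (dseq _))],
    which by induction is a double coboundary. *)
Lemma Sd_dseq n p l : size l = n -> Sd n (dseq p) l = dseq (Sd n.-1 p) l.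
Proof.
elim: n p l => [|n IH] p l ln; first by case: l ln.
rewrite /= (_ : consf _ _ = fun m => p m - dseq (consf p (bary l)) m)//.
rewrite (funext (SdB n _ _)).
rewrite dseqB [X in _ - X](_ : _ = 0) ?subr0//.
rewrite -[RHS](dseq_dseq (Sd n.-1 (consf p (bary l))) l).
by apply: eq_dseq => m; rewrite ln => -[mn] _; exact: IH.
Qed.

(** Dual to $dT + Td = 1 - S$. By the cone formula $dTv = v - Tdv - b * (dv - dTdv)$, and by
    induction the last cone is $b * S(dv) = Sv$. *)
Lemma dseq_Td n p l : size l = n ->
  dseq (Td n.-1 p) l = p l - Sd n p l - Td n (dseq p) l.
Proof.
elim: n p l => [|n IH] p l ln; first by case: l ln => //= _; ring.
rewrite /= (_ : consf (dseq p) _ = fun m => p m - dseq (consf p (bary l)) m)//.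
rewrite (funext (TdB n _ _)).
rewrite dseqB (@eq_dseq _ _ (Td n (dseq _)) (fun m => (consf p (bary l) m -
  Sd n (consf p (bary l)) m) - dseq (Td n.-1 (consf p (bary l))) m)).
  by rewrite !dseqB dseq_dseq; ring.
by move=> m; rewrite ln => -[mn] _; rewrite IH//; ring.
Qed.

(** A substitute for convexity: the new vertices in a subdivision are iterated barycenters of the
    old ones. *)
Definition bary_closed C := forall l, l != [::] -> {in l, forall x, C x} ->
  C (bary l).

Lemma bary_closedI C C' : bary_closed C -> bary_closed C' ->
  bary_closed (C `&` C').
Proof.
by move=> bC bC' l l0 CC'; split; [apply: bC|apply: bC'] => // x /CC'[].
Qed.

Lemma bary_in_ball l (x : E) (e : RR) : l != [::] ->
  {in l, forall y, `|x - y| <= e} -> `|x - bary l| <= e.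
Proof.
move=> l0 le; have l0' : 0 < (size l)%:R :> RR by rewrite ltr0n lt0n size_eq0.
have -> : x - bary l = (size l)%:R^-1 *: \sum_(y <- l) (x - y).
  rewrite big_split /= scalerDr sumrN scalerN big_const_seq count_predT.
  rewrite iter_addr_0 -scaler_nat scalerA mulVf ?scale1r//.
  by rewrite gt_eqF.
rewrite normrZ gtr0_norm ?invr_gt0// ler_pdivrMl//.
apply: le_trans (ler_norm_sum _ _ _) _.
rewrite big_seq; apply: le_trans (ler_sum _ le) _.
by rewrite -big_seq big_const_seq count_predT iter_addr_0 mulr_natl.
Qed.

Lemma bary_closed_ball (x : E) (e : RR) : bary_closed [set y | `|x - y| <= e].
Proof. by move=> l l0; exact: bary_in_ball. Qed.

(** * Diameters of affine simplices and the mesh of subdivisions *)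

Definition pairwise_le (e : RR) l :=
  {in l &, forall x y, `|x - y| <= e}.

Lemma pairwise_le_bounded l : exists2 e : RR, 0 < e & pairwise_le e l.
Proof.
(* Adding 1 keeps the bound positive when all vertices coincide. *)
exists (1 + \sum_(x <- l) \sum_(y <- l) `|x - y|).
  by rewrite ltr_pwDl// !sumr_ge0// => x _; rewrite sumr_ge0.
move=> x y xl yl; apply: ler_wpDl => //.
rewrite (big_rem x)//= (big_rem y)//= -addrA lerDl addr_ge0// ?sumr_ge0//.
by move=> z _; exact: sumr_ge0.
Qed.

(** In the average of the [size l] differences [y - x] the one with [y = x] is 0, which leaves
    [(size l).-1] terms of norm at most [e]. *)
Lemma bary_dist l (e : RR) x : pairwise_le e l -> x \in l ->
  `|bary l - x| <= (size l).-1%:R / (size l)%:R * e.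
Proof.
move=> le xl; have l0' : 0 < (size l)%:R :> RR.
  by rewrite ltr0n lt0n size_eq0; case: (l) xl.
have -> : bary l - x = (size l)%:R^-1 *: \sum_(y <- l) (y - x).
  rewrite big_split /= scalerDr big_const_seq count_predT.
  rewrite iter_addr_0 mulNrn scalerN -scaler_nat scalerA mulVf ?scale1r//.
  by rewrite gt_eqF.
rewrite normrZ gtr0_norm ?invr_gt0// ler_pdivrMl//.
rewrite mulrA [_ * (_ / _)]mulrC divfK ?gt_eqF//.
rewrite (big_rem x)//= subrr add0r.
apply: le_trans (ler_norm_sum _ _ _) _.
rewrite big_seq.
have h y : y \in rem x l -> `|y - x| <= e.
  by move=> /mem_rem yl; exact: le.
apply: le_trans (ler_sum _ h) _.
rewrite -big_seq big_const_seq count_predT iter_addr_0 size_rem//.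
by rewrite mulr_natl.
Qed.

Variable N : nat.
(** The contraction factor of one subdivision, uniform for simplices of dimension at most [N]. *)
Let r : RR := N%:R / N.+1%:R.

(** Cochains see a subdivision only through their values on it, so its locality and the shrinking of
    its mesh take the form of a congruence. Its simplices consist of [bary l] and a simplex of a
    subdivided proper face. *)
Lemma eq_Sd n p q l C e : (n <= N.+1)%N -> size l = n -> bary_closed C ->
  {in l, forall x, C x} -> pairwise_le e l ->
  (forall m, size m = n -> {in m, forall x, C x} -> pairwise_le (r * e) m ->
    p m = q m) -> Sd n p l = Sd n q l.
Proof.
elim: n p q l C => [|n IH] p q l C nN ln bC Cl le pq /=.
  by apply: pq => //; case: l ln {Cl le} => // _ x y.
have l0 : l != [::] by case: l ln {Cl le}.
have e0 : 0 <= e.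
  by case: l l0 le {ln Cl} => // x l _ /(_ x x); rewrite subrr normr0 mem_head; exact.
have bl : {in l, forall x, `|bary l - x| <= r * e}.
  move=> x xl; apply: le_trans (bary_dist le xl) _; rewrite ln /=.
  apply: ler_wpM2r => //; rewrite /r ler_pdivrMr// mulrAC ler_pdivlMr//.
  by rewrite -!natrM ler_nat !mulnS mulnC leq_add2r.
apply: eq_dseq => m; rewrite ln => -[mn] ml.
(* The ball records that the vertices of the subdivided face stay within [r * e] of the new vertex
   [bary l]. *)
apply: (IH _ _ _ (C `&` [set y | `|bary l - y| <= r * e])) => //.
- exact: ltnW.
- exact: bary_closedI bC (@bary_closed_ball _ _).
- by move=> x /ml xl; split; [exact: Cl|exact: bl].
- by move=> x y /ml xl /ml yl; exact: le.
- move=> m' m'n m'C m'e; apply: (pq (_ :: _)) => /=; first by rewrite m'n.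
  + move=> x; rewrite inE => /orP[/eqP ->|/m'C[]//]; exact: bC.
  + move=> x y; rewrite !inE => /orP[/eqP ->|xm] /orP[/eqP ->|ym].
    * by rewrite subrr normr0 mulr_ge0// divr_ge0.
    * by have [] := m'C _ ym.
    * by rewrite distrC; have [] := m'C _ xm.
    * exact: m'e.
Qed.

Lemma eq_iter_Sd i n p q l C e : (n <= N.+1)%N -> size l = n -> bary_closed C ->
  {in l, forall x, C x} -> pairwise_le e l ->
  (forall m, size m = n -> {in m, forall x, C x} -> pairwise_le (r ^+ i * e) m ->
    p m = q m) -> iter i (Sd n) p l = iter i (Sd n) q l.
Proof.
move=> nN + bC; elim: i l e => [|i IH] l e ln Cl le pq /=.
  by apply: pq => //; rewrite expr0 mul1r.
apply: (eq_Sd nN ln bC Cl le) => m mn Cm me; apply: (IH m (r * e)) => // m' m'n Cm' m'e.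
by apply: pq => //; rewrite exprSr -mulrA.
Qed.

(** [Td] keeps vertices of [l] itself, so [C] is controlled but no diameter shrinks. *)
Lemma eq_Td n p q l C : size l = n -> bary_closed C ->
  {in l, forall x, C x} ->
  (forall m, size m = n.+1 -> {in m, forall x, C x} -> p m = q m) ->
  Td n p l = Td n q l.
Proof.
move=> + bC; elim: n p q l => [|n IH] p q l ln Cl pq //=.
have l0 : l != [::] by case: l ln {Cl}.
rewrite pq /= ?ln//; last first.
  by move=> x; rewrite inE => /orP[/eqP ->|/Cl//]; exact: bC.
congr (_ - _); apply: eq_dseq => m; rewrite ln => -[mn] ml.
apply: IH => // [x /ml/Cl//|m' m'n m'C]; apply: (pq (_ :: _)) => /=; first by rewrite m'n.
by move=> x; rewrite inE => /orP[/eqP ->|/m'C//]; exact: bC.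
Qed.

Lemma iter_SdB i n p q l : size l = n ->
  iter i (Sd n) (fun m => p m - q m) l = iter i (Sd n) p l - iter i (Sd n) q l.
Proof.
elim: i l => //= i IH l ln; rewrite -SdB; exact: (eq_Sd_size ln).
Qed.

Lemma iter_Sd_dseq i n p l : size l = n.+1 ->
  iter i (Sd n.+1) (dseq p) l = dseq (iter i (Sd n) p) l.
Proof.
elim: i l => //= i IH l ln.
by rewrite -[n in RHS]/n.+1.-1 -Sd_dseq//; exact: (eq_Sd_size ln).
Qed.

(* Telescoping of the chain homotopy between the identity and the iterated
   subdivision, for a functional closed on [C]. *)
Lemma dseq_iter_Td i n p l C : size l = n.+1 -> (n <= N)%N -> bary_closed C ->
  {in l, forall x, C x} ->
  (forall m, size m = n.+2 -> {in m, forall x, C x} -> dseq p m = 0) ->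
  dseq (iter i (Sd n) (Td n p)) l = iter i (Sd n.+1) p l - iter i.+1 (Sd n.+1) p l.
Proof.
move=> ln nN bC Cl p0; rewrite -iter_Sd_dseq//.
have [e _ le] := pairwise_le_bounded l.
rewrite iterSr -iter_SdB//.
apply: (eq_iter_Sd _ ln bC Cl le) => // m mn Cm _.
rewrite -[n in Td n]/n.+1.-1 dseq_Td//.
by rewrite (@eq_Td _ (dseq p) (fun=> 0) _ C)// Td0 subr0.
Qed.

End Barycentric.

(** * Naturality of subdivision under linear maps *)

Section Naturality.
Variables (K : comPzRingType) (E E' : normedModType RR) (h : {linear E -> E'}).
Implicit Types (p : seq E' -> K) (l : seq E).

Lemma bary_map l : bary (map h l) = h (bary l).
Proof. by rewrite /bary size_map big_map linearZ_LR [h _]linear_sum. Qed.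

Lemma Sd_map n p l : Sd n (p \o map h) l = Sd n p (map h l).
Proof.
elim: n p l => //= n IH p l; rewrite -dseq_map bary_map; apply: eq_dseq => m _ _.
by rewrite /= -IH.
Qed.

Lemma Td_map n p l : Td n (p \o map h) l = Td n p (map h l).
Proof.
elim: n p l => //= n IH p l; rewrite -dseq_map bary_map; congr (_ - _).
by apply: eq_dseq => m _ _; rewrite /= -IH.
Qed.

Lemma iter_Sd_map i n p l :
  iter i (Sd n) (p \o map h) l = iter i (Sd n) p (map h l).
Proof.
elim: i l => //= i IH l; rewrite -Sd_map; congr (Sd n _ l).
by apply/funext => m /=; exact: IH.
Qed.

End Naturality.

(** * Affine simplices *)

Section AffineSimplices.
Variable N : nat.
Implicit Types l m : seq 'rV[RR]_N.+1.

(** The affine simplex with vertices [l] in barycentric coordinates. As a formula on the whole space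
    it is linear, so the naturality of subdivision applies to it. *)
Definition aff p l (x : 'rV[RR]_p.+1) : 'rV[RR]_N.+1 :=
  \sum_(j < p.+1) x ord0 j *: l`_j.

Lemma aff_is_linear p l : linear (aff (p := p) l).
Proof.
move=> a x y; rewrite /aff scaler_sumr -big_split /=; apply: eq_bigr => j _.
by rewrite !mxE scalerDl scalerA.
Qed.

HB.instance Definition _ p l :=
  GRing.isLinear.Build RR 'rV[RR]_p.+1 'rV[RR]_N.+1 *:%R (aff (p := p) l)
    (aff_is_linear l).

Lemma continuous_aff p l : continuous (aff (p := p) l).
Proof.
apply: continuous_big => [|j _ x]; first exact: add_continuous.
have jx : {for x, continuous (fun z : 'rV[RR]_p.+1 => z ord0 j)}.
  exact: coord_continuous.
exact: (cvgZr_tmp jx).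
Qed.

Lemma size_nth_mem p l (j : 'I_p.+1) : size l = p.+1 -> l`_j \in l.
Proof. by move=> lp; rewrite mem_nth// lp. Qed.

Lemma norm_aff_le p l (y : 'rV[RR]_N.+1) (e : RR) (x : 'rV[RR]_p.+1) :
  size l = p.+1 -> {in l, forall z, `|y - z| <= e} -> std_simplex p x ->
  `|y - aff l x| <= e.
Proof.
move=> lp le [x0 x1].
have -> : y - aff l x = \sum_(j < p.+1) x ord0 j *: (y - l`_j).
  under eq_bigr do rewrite scalerBr.
  by rewrite sumrB -scaler_suml x1 scale1r.
apply: le_trans (ler_norm_sum _ _ _) _.
rewrite -[leRHS]mul1r -x1 mulr_suml; apply: ler_sum => j _.
by rewrite normrZ ger0_norm// ler_wpM2l// le// size_nth_mem.
Qed.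

Lemma aff_simplex p l (x : 'rV[RR]_p.+1) :
  size l = p.+1 -> {in l, forall z, std_simplex N z} -> std_simplex p x ->
  std_simplex N (aff l x).
Proof.
move=> lp ls [x0 x1]; split=> [i|].
  rewrite summxE; apply: sumr_ge0 => j _; rewrite mxE mulr_ge0//.
  by have [+ _] := ls _ (size_nth_mem j lp).
under eq_bigr do rewrite summxE.
rewrite exchange_big -[RHS]x1; apply: eq_bigr => j _.
under eq_bigr do rewrite mxE.
rewrite -mulr_sumr; have [_ ->] := ls _ (size_nth_mem j lp).
by rewrite mulr1.
Qed.

Lemma bary_closed_simplex : bary_closed (std_simplex N).
Proof.
move=> l l0 ls; have l0' : 0 < (size l)%:R :> RR by rewrite ltr0n lt0n size_eq0.
split=> [i|].
  rewrite mxE mulr_ge0 ?invr_ge0 ?ler0n// summxE big_seq sumr_ge0//.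
  by move=> z /ls[+ _].
under eq_bigr do rewrite mxE summxE.
rewrite -mulr_sumr exchange_big /= big_seq.
under eq_bigr => z zl do (have [_ ->] := ls _ zl).
rewrite -big_seq big_const_seq count_predT iter_addr_0.
by rewrite mulVf// gt_eqF.
Qed.

End AffineSimplices.

Lemma aff_map N p q (l : seq 'rV[RR]_N.+1) (m : seq 'rV[RR]_p.+1)
    (x : 'rV[RR]_q.+1) : size m = q.+1 ->
  aff [seq aff l z | z <- m] x = aff l (aff m x).
Proof.
move=> mq; rewrite [aff m x]/aff linear_sum; apply: eq_bigr => j _.
by rewrite linearZ (nth_map 0) ?mq.
Qed.

(** * Vertices of the standard simplex; its faces as affine simplices *)

Definition verts n : seq 'rV[RR]_n.+1 := [seq delta_mx ord0 i | i <- enum 'I_n.+1].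

Lemma size_verts n : size (verts n) = n.+1.
Proof. by rewrite size_map size_enum_ord. Qed.

Lemma nth_verts n (i : nat) (k : 'I_n.+1) : (i <= n)%N ->
  (verts n)`_i ord0 k = (i == k :> nat)%:R.
Proof.
move=> ni; rewrite (nth_map ord0) ?size_enum_ord// mxE eqxx /= eq_sym.
by rewrite -val_eqE /= nth_enum_ord.
Qed.

Lemma verts_simplex n : {in verts n, forall z, std_simplex n z}.
Proof.
move=> z /mapP[i _ ->]; split=> [j|]; first by rewrite mxE ler0n.
rewrite (bigD1 i)//= big1 => [|j ji]; first by rewrite mxE !eqxx addr0.
by rewrite mxE (negbTE ji).
Qed.

Lemma aff_verts n (x : 'rV[RR]_n.+1) : aff (verts n) x = x.
Proof.
rewrite [RHS]row_sum_delta; apply: eq_bigr => j _; congr (_ *: _).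
by rewrite (nth_map ord0) ?size_enum_ord// nth_ord_enum.
Qed.

Lemma map_aff_verts N p (l : seq 'rV[RR]_N.+1) : size l = p.+1 ->
  [seq aff l z | z <- verts p] = l.
Proof.
move=> lp; apply: (@eq_from_nth _ 0); rewrite size_map size_verts// => i ip.
rewrite (nth_map 0) ?size_verts// /aff (bigD1 (Ordinal ip))//= big1.
  by rewrite nth_verts// eqxx scale1r addr0.
move=> j; rewrite -val_eqE /= => ji.
by rewrite nth_verts// eq_sym (negbTE ji) scale0r.
Qed.

(** Translates faces into sublists: [face] becomes [del], and below [front] and [back] become [take]
    and [drop], so that singular cochains can be treated as functionals on lists. *)
Lemma aff_face n (i : 'I_n.+2) (x : 'rV[RR]_n.+1) :
  aff (del i (verts n.+1)) x = face i x.
Proof.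
apply/rowP => k; rewrite summxE mxE.
have E (j : 'I_n.+1) : (x ord0 j *: (del i (verts n.+1))`_j) ord0 k =
    x ord0 j * (lift i j == k)%:R.
  rewrite mxE nth_cat size_take size_verts ltn_ord -val_eqE /=.
  case: ltnP => ij.
    rewrite (nth_take _ ij) (nth_verts _ (ltnW (ltn_ord j))).
    by rewrite /bump leqNgt ij.
  rewrite nth_drop addSn (subnKC ij) (nth_verts _ (ltn_ord j)).
  by rewrite /bump ij.
under eq_bigr do rewrite E.
case: unliftP => [k' ->|->].
  rewrite (bigD1 k')//= eqxx mulr1 big1 ?addr0// => j jk.
  by rewrite (inj_eq lift_inj) (negbTE jk) mulr0.
by rewrite big1// => j _; rewrite eq_sym (negbTE (neq_lift _ _)) mulr0.
Qed.

Lemma aff_front n p (x : 'rV[RR]_p.+1) : (p <= n)%N ->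
  aff (take p.+1 (verts n)) x = front n p x.
Proof.
move=> pn; apply/rowP => k; rewrite summxE mxE.
have E (j : 'I_p.+1) : (x ord0 j *: (take p.+1 (verts n))`_j) ord0 k =
    x ord0 j * (j == k :> nat)%:R.
  by rewrite mxE nth_take// nth_verts// (leq_trans _ pn)// -ltnS.
under eq_bigr do rewrite E.
case: leqP => kp; last first.
  by rewrite big1// => j _; rewrite ltn_eqF ?mulr0// (leq_ltn_trans _ kp)// -ltnS.
rewrite (bigD1 (inord k))//= inordK// eqxx mulr1 big1 ?addr0// => j.
by rewrite -val_eqE /= inordK// => /negbTE ->; rewrite mulr0.
Qed.

Lemma aff_back n p (x : 'rV[RR]_(n - p).+1) : (p <= n)%N ->
  aff (drop p (verts n)) x = back n p x.
Proof.
move=> pn; apply/rowP => k; rewrite summxE mxE.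
have E (j : 'I_(n - p).+1) : (x ord0 j *: (drop p (verts n))`_j) ord0 k =
    x ord0 j * ((p + j)%N == k)%:R.
  rewrite mxE nth_drop nth_verts// -leq_subRL// -ltnS; exact: ltn_ord.
under eq_bigr do rewrite E.
case: leqP => kp; last first.
  by rewrite big1// => j _; rewrite gtn_eqF ?mulr0// (leq_trans kp)// leq_addr.
have kn : (k - p < (n - p).+1)%N by rewrite ltnS leq_sub2r// -ltnS.
rewrite (bigD1 (inord (k - p)))//= (inordK kn) (subnKC kp) eqxx mulr1 big1 ?addr0// => j.
rewrite -val_eqE /= inordK// => jk; rewrite -[X in _ == X](subnKC kp).
by rewrite eqn_add2l (negbTE jk) mulr0.
Qed.

(** * The cup product of singular cochains *)

Lemma aff_del N n (i : 'I_n.+2) (l : seq 'rV[RR]_N.+1) (x : 'rV[RR]_n.+1) :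
  size l = n.+2 -> aff (del i l) x = aff l (face i x).
Proof.
move=> ln; rewrite -aff_face -aff_map ?map_del ?map_aff_verts//.
by apply: succn_inj; rewrite size_del size_verts.
Qed.

Lemma continuous_within_comp (S T U : topologicalType) (A : set S) (B : set T)
    (h : S -> T) (g : T -> U) :
  {within B, continuous g} -> continuous h -> (forall x, A x -> B (h x)) ->
  {within A, continuous (g \o h)}.
Proof.
move=> /subspace_continuousP gc hc AB; apply/subspace_continuousP => x Ax.
apply: cvg_trans (gc _ (AB _ Ax)) => D; rewrite /= !nbhs_simpl /= /within /=.
move=> wD; have h1 : \forall y \near x, B (h y) -> D (g (h y)) by exact: (hc x _ wD).
by apply: filterS h1 => y hy Ay; exact/hy/AB.
Qed.

#[local] Arguments gcup {K X} u v n s.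

Section SingularCochains.
Variables (K : comPzRingType) (X : topologicalType).

(* The functional induced by the cochains [u] on the affine simplices of the
   domain of [s]; the value [0] on the empty list means no augmentation. *)
Definition Psi N (s : 'rV[RR]_N.+1 -> X) (u : gcochain K X) (l : seq 'rV[RR]_N.+1)
    : K :=
  if size l is p.+1 then u p (s \o aff (p := p) l) else 0.

Definition gcobound (u : gcochain K X) : gcochain K X :=
  fun n => if n is m.+1 then cobound (u m) else fun=> 0.

#[local] Arguments gcobound u n s : clear implicits.

Definition gcocycle (u : gcochain K X) :=
  forall n, wd_cochain (u n) /\ cocycle (u n).

Section Simplex.
Variables (N : nat) (s : 'rV[RR]_N.+1 -> X).
Implicit Types (u v : gcochain K X) (l : seq 'rV[RR]_N.+1).

Lemma Psi_size p u l : size l = p.+1 -> Psi s u l = u p (s \o aff (p := p) l).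
Proof. by rewrite /Psi => ->. Qed.

Lemma Psi_aff q u l m : size l = q.+1 -> Psi (s \o aff (p := q) l) u m =
  Psi s u (map (aff (p := q) l) m).
Proof.
move=> lq; rewrite /Psi size_map; case E : (size m) => [|p]//.
by congr (u p _); apply/funext => x /=; rewrite aff_map.
Qed.

(** Identities of cochains are reduced to identities of functionals on lists by evaluating at
    [verts N]. *)
Lemma Psi_verts u : Psi s u (verts N) = u N s.
Proof.
rewrite (Psi_size _ (size_verts N)); congr (u N _).
by apply/funext => x /=; rewrite aff_verts.
Qed.

Lemma Psi_gcobound u l : Psi s (gcobound u) l = dseq (Psi s u) l.
Proof.
case E : (size l) => [|[|n]].
- by rewrite /Psi E; case: l E.
(* On a single vertex [dseq] yields the augmentation [Psi s u [::]], which is 0. *)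
- by rewrite /Psi E; case: l E => // x [] //= _; rewrite subrr.
rewrite (Psi_size _ E) dseqE E; apply: eq_bigr => i _; congr (_ * _).
have il : (i < size l)%N by rewrite E.
rewrite (Psi_size (p := n)); last by apply: succn_inj; rewrite size_del// E.
by congr (u n _); apply/funext => x /=; rewrite aff_del.
Qed.

Lemma Psi_gcup u v l : Psi s (gcup u v) l = cupseq (Psi s u) (Psi s v) l.
Proof.
case E : (size l) => [|n]; first by rewrite /Psi E; case: l E.
rewrite (Psi_size _ E) cupseqE E; apply: eq_bigr => p _.
have pn : (p <= n)%N by rewrite -ltnS.
have pl : size (take p.+1 (verts n)) = p.+1 by rewrite size_takel// size_verts.
have nl : size (drop p (verts n)) = (n - p).+1 by rewrite size_drop size_verts subSn.
rewrite (Psi_size (p := p)); last by rewrite size_takel// E.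
rewrite (Psi_size (p := (n - p)%N)); last by rewrite size_drop E subSn.
congr (_ * _); [congr (u p _)|congr (v (n - p)%N _)]; apply/funext => x /=.
- by rewrite -aff_front// -aff_map// map_take map_aff_verts.
- by rewrite -aff_back// -aff_map// map_drop map_aff_verts.
Qed.

Hypothesis ss : singular s.

Lemma singular_aff p l : size l = p.+1 -> {in l, forall z, std_simplex N z} ->
  singular (s \o aff (p := p) l).
Proof.
move=> lp ls; apply: (continuous_within_comp ss); first exact: continuous_aff.
by move=> x; exact: aff_simplex.
Qed.

Lemma Psi_cocycle u l : (forall n, cocycle (u n)) ->
  {in l, forall z, std_simplex N z} -> dseq (Psi s u) l = 0.
Proof.
move=> cu ls; rewrite -Psi_gcobound /Psi.
case E : (size l) => [|[|n]]//=; exact/cu/singular_aff.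
Qed.

End Simplex.

Implicit Types (u v : gcochain K X).

Lemma eq_Psi N s t u l : (forall n, wd_cochain (u n)) ->
  @singular X N s -> singular t ->
  {in std_simplex N, s =1 t} -> {in l, forall z, std_simplex N z} ->
  Psi s u l = Psi t u l.
Proof.
move=> wu ss st stE ls; rewrite /Psi; case E : (size l) => [//|p].
apply: wu; [exact: singular_aff|exact: singular_aff|].
by move=> x /set_mem sx /=; apply/stE/mem_set/aff_simplex.
Qed.

Lemma wd_gcup u v n : (forall n, wd_cochain (u n)) ->
  (forall n, wd_cochain (v n)) -> wd_cochain (gcup u v n).
Proof.
move=> wu wv s t ss st stE; rewrite -!Psi_verts !Psi_gcup.
by apply: eq_cupseq => m ml _; apply: eq_Psi => // z /ml; exact: verts_simplex.
Qed.

Lemma wd_gcobound u n : (forall n, wd_cochain (u n)) -> wd_cochain (gcobound u n).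
Proof.
move=> wu s t ss st stE; rewrite -!Psi_verts !Psi_gcobound.
by apply: eq_dseq => m _ ml; apply: eq_Psi => // z /ml; exact: verts_simplex.
Qed.

Lemma gcocycle_gcobound u : (forall n, wd_cochain (u n)) ->
  gcocycle (gcobound u).
Proof.
move=> wu n; split=> [|s ss]; first exact: wd_gcobound.
rewrite -[LHS]/(gcobound (gcobound u) n.+1 s) -Psi_verts Psi_gcobound.
rewrite -(dseq_dseq (Psi s u) (verts n.+1)); apply: eq_dseq => m _ _.
by rewrite Psi_gcobound.
Qed.

Lemma dseq_cupseq_Psi u v N (s : 'rV[RR]_N.+1 -> X) l :
  dseq (cupseq (Psi s u) (Psi s v)) l =
  cupseq (dseq (Psi s u)) (Psi s v) l + cupseq (bar (Psi s u)) (dseq (Psi s v)) l.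
Proof. by rewrite dseq_cupseq// [Psi s u [::]]/Psi mul0r subr0. Qed.

Lemma dseq_Psi_gcup u v N (s : 'rV[RR]_N.+1 -> X) l :
  dseq (Psi s (gcup u v)) l = dseq (cupseq (Psi s u) (Psi s v)) l.
Proof. by apply: eq_dseq => m _ _; rewrite Psi_gcup. Qed.

(** In the Leibniz rule the other term contains the coboundary of the cocycle [v], which vanishes on
    affine simplices. *)
Lemma gcobound_gcupl u v n s : @singular X n s -> (forall n, cocycle (v n)) ->
  gcobound (gcup u v) n s = gcup (gcobound u) v n s.
Proof.
move=> ss cv; rewrite -!Psi_verts Psi_gcobound Psi_gcup dseq_Psi_gcup dseq_cupseq_Psi.
rewrite [X in _ + X](@eq_cupseq _ _ _ (bar (Psi s u)) _ (fun=> 0))//; last first.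
  by move=> m ml _; apply: Psi_cocycle => // z /ml; exact: verts_simplex.
rewrite cupseq0r addr0; apply: eq_cupseq => // m _ _.
by rewrite Psi_gcobound.
Qed.

Definition gbar u : gcochain K X := fun n s => (-1) ^+ n * u n s.

#[local] Arguments gbar u n s : clear implicits.

Lemma Psi_gbar u N (s : 'rV[RR]_N.+1 -> X) l : Psi s (gbar u) l = bar (Psi s u) l.
Proof.
rewrite /Psi /bar; case: (size l) => [|p]; first by rewrite mulr0.
by rewrite /gbar !exprS !mulN1r opprK.
Qed.

(** The sign in [gbar] cancels that of the Leibniz rule; the other term contains the coboundary of
    the cocycle [u]. *)
Lemma gcobound_gcupr u v n s : @singular X n s -> (forall n, cocycle (u n)) ->
  gcobound (gcup (gbar u) v) n s = gcup u (gcobound v) n s.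
Proof.
move=> ss cu; rewrite -!Psi_verts Psi_gcobound Psi_gcup dseq_Psi_gcup dseq_cupseq_Psi.
rewrite (funext (Psi_gbar u s)) barK.
rewrite [X in X + _](@eq_cupseq _ _ _ (fun=> 0) _ (Psi s v))//; last first.
  move=> m ml _; rewrite dseq_bar Psi_cocycle ?mulr0// => z /ml.
  exact: verts_simplex.
rewrite cupseq0l add0r; apply: eq_cupseq => // m _ _.
by rewrite Psi_gcobound.
Qed.

Lemma gcocycle_gcup u v : gcocycle u -> gcocycle v -> gcocycle (gcup u v).
Proof.
move=> cu cv n; split=> [|s ss].
  by apply: wd_gcup => m; [case: (cu m)|case: (cv m)].
rewrite -[LHS]/(gcobound (gcup u v) n.+1 s) gcobound_gcupl//; last first.
  by move=> m; case: (cv m).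
rewrite -Psi_verts Psi_gcup (@eq_cupseq _ _ _ (fun=> 0) _ (Psi s v)) ?cupseq0l//.
move=> m ml _; rewrite Psi_gcobound Psi_cocycle// => [k|z /ml].
  by case: (cu k).
exact: verts_simplex.
Qed.

End SingularCochains.

(** * Small simplices *)

(** After [i] subdivisions the simplices have diameter at most [r ^+ i * d] with [r < 1], eventually
    at most [e]; each then lies in the ball about its first vertex, where [p] is 0. *)
Lemma iter_Sd_small (K : comPzRingType) (E : normedModType RR) (C : set E)
    (p : seq E -> K) n l e : bary_closed C ->
  size l = n.+1 -> {in l, forall x, C x} -> 0 < e ->
  (forall m x, size m = n.+1 -> C x ->
    {in m, forall y, C y /\ `|x - y| <= e} -> p m = 0) ->
  \forall i \near \oo, iter i (Sd n.+1) p l = 0.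
Proof.
move=> bC ln Cl e0 p0; pose r : RR := n%:R / n.+1%:R.
have [d d0 ld] := pairwise_le_bounded l.
have r1 : `|r| < 1.
  by rewrite ger0_norm ?divr_ge0// ltr_pdivrMr// mul1r ltr_nat.
have /(@cvgrPdist_le _ RR^o nat) /(_ _ (divr_gt0 e0 d0)) := cvg_expr r1.
apply: filterS => i; rewrite sub0r normrN => ri.
rewrite -(@iter_Sd0 K E i n.+1 l).
apply: (eq_iter_Sd (N := n) _ ln bC Cl ld) => // m mn Cm md.
case: m mn Cm md => // x m mn Cm md; apply: (p0 _ x) => // [|y ym].
  by apply: Cm; rewrite mem_head.
split; first exact: Cm.
apply: le_trans (md _ _ (mem_head _ _) ym) _; rewrite -ler_pdivlMr//.
exact: le_trans (ler_norm _) ri.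
Qed.

(** * Compactness of the standard simplex and Lebesgue numbers *)

Lemma compact_simplex n : compact (std_simplex n).
Proof.
apply: bounded_closed_compact.
  exists 1; split; first exact: num_real.
  move=> M M1 x [x0 x1]; apply: le_trans (ltW M1).
  rewrite /Num.norm /= mx_normrE; apply: bigmax_le => //= -[i j] _ /=.
  rewrite ord1 ger0_norm// -x1 (bigD1 j)//= lerDl sumr_ge0//.
have -> : std_simplex n = \bigcap_i [set x | 0 <= x ord0 i] `&`
    [set x | \sum_(i < n.+1) x ord0 i = 1].
  apply/seteqP; split=> x /=.
    by move=> [x0 x1]; split => // i _; exact: x0.
  by move=> [x0 x1]; split => // i; exact: x0.
apply: closedI.
  apply: closed_bigI => i _.
  apply: (@preimage_closed _ _ (fun x : 'rV[RR]_n.+1 => x ord0 i) [set y | 0 <= y]).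
    by move=> x _; exact: coord_continuous.
  exact: closed_ge.
apply: (@preimage_closed _ _ (fun x : 'rV[RR]_n.+1 => \sum_(i < n.+1) x ord0 i) [set 1]).
  move=> x _; apply: continuous_big => [|j _]; first exact: (@add_continuous RR^o).
  exact: coord_continuous.
exact: closed_eq.
Qed.

Lemma lebesgue_number (X : topologicalType) n (s : 'rV[RR]_n.+1 -> X) (V W : set X) :
  singular s -> open V -> open W -> V `|` W = setT ->
  exists2 e : RR, 0 < e & forall x, std_simplex n x ->
    (forall y, std_simplex n y -> `|x - y| <= e -> V (s y)) \/
    (forall y, std_simplex n y -> `|x - y| <= e -> W (s y)).
Proof.
move=> /subspace_continuousP ss oV oW VW.
have aux U x : open U -> std_simplex n x -> U (s x) ->
  \forall x' \near x & e \near 0^'+,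
    forall y, std_simplex n y -> `|x' - y| <= e -> U (s y).
  move=> oU sx Ux.
  have /(ss _ sx) : nbhs (s x) U by exact: open_nbhs_nbhs.
  rewrite /= nbhs_simpl /= /within /= => /nbhs_normP[d /= d0 dU].
  (* The radius [d] is halved: one half bounds [|x - x'|], the other [e]. *)
  near=> x' e => y sy xy; apply: dU => //=.
  rewrite (splitr d) -[x in `|x - _|](subrK x') -addrA (le_lt_trans (ler_normD _ _))//.
  rewrite ltrD//.
    near: x'; apply/(@nbhs_normP RR 'rV[RR]_n.+1); exists (d / 2) => //=; exact: divr_gt0.
  rewrite (le_lt_trans xy)//=; near: e; apply: nbhs_right_lt; exact: divr_gt0.
have cov x : std_simplex n x -> \forall x' \near x & e \near 0^'+,
    (forall y, std_simplex n y -> `|x' - y| <= e -> V (s y)) \/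
    (forall y, std_simplex n y -> `|x' - y| <= e -> W (s y)).
  move=> sx; have : (V `|` W) (s x) by rewrite VW.
  move=> [Vx|Wx].
    by apply: filterS (aux V x oV sx Vx) => -[? ?] ?; left.
  by apply: filterS (aux W x oW sx Wx) => -[? ?] ?; right.
(* Compactness makes the locally valid [e] uniform over the simplex. *)
have /compact_near_coveringP /(_ _ _ _ _ cov) h := @compact_simplex n.
have [e [e0 he]] := filter_ex (filterI (nbhs_right_gt (0 : RR)) h).
by exists e.
Unshelve. all: by end_near.
Qed.

#[local] Arguments gcobound {K X} u n s.
#[local] Arguments gbar {K X} u n s.

Lemma singular_face (X : topologicalType) n (s : 'rV[RR]_n.+2 -> X) j :
  singular s -> singular (s \o face j).
Proof.
move=> ss; have -> : s \o face j = s \o aff (p := n) (del j (verts n.+1)).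
  by apply/funext => x /=; rewrite aff_face.
apply: singular_aff => //; first by apply: succn_inj; rewrite size_del size_verts.
by move=> z /del_sub; exact: verts_simplex.
Qed.

Lemma face_simplex n (j : 'I_n.+2) x : std_simplex n x -> std_simplex n.+1 (face j x).
Proof.
move=> sx; rewrite -aff_face; apply: aff_simplex => //.
  by apply: succn_inj; rewrite size_del size_verts.
by move=> z /del_sub; exact: verts_simplex.
Qed.

(* Sum of an eventually vanishing sequence; junk otherwise. *)
Definition finsum (K : nmodType) (h : nat -> K) : K :=
  \sum_(i < xget 0%N [set M | forall i, (M <= i)%N -> h i = 0]) h i.

Lemma finsumE (K : nmodType) (h : nat -> K) M :
  (forall i, (M <= i)%N -> h i = 0) -> finsum h = \sum_(i < M) h i.
Proof.
move=> hM; rewrite /finsum; case: xgetP => [M' _ /= hM'|/(_ M)/(_ hM)//].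
wlog MM : M M' hM hM' / (M <= M')%N.
  by move=> wl; have [?|/ltnW ?] := leqP M M'; [exact: wl|rewrite -(wl M' M)].
rewrite -(subnKC MM) big_split_ord /= [X in _ + X]big1 ?addr0// => i _.
by rewrite hM// leq_addr.
Qed.

(** * Cocycles vanishing on the simplices inside [V] and on those inside [W] *)

Section SmallSimplices.
Variables (K : comPzRingType) (X : topologicalType) (u : gcochain K X).
#[local] Arguments u : clear implicits.
Variables V W : set X.
Hypotheses (cu : gcocycle u) (oV : open V) (oW : open W) (VW : V `|` W = setT).
Hypothesis uV : forall n s, @singular X n s ->
  (forall x, std_simplex n x -> V (s x)) -> u n s = 0.
Hypothesis uW : forall n s, @singular X n s ->
  (forall x, std_simplex n x -> W (s x)) -> u n s = 0.

Let wu n : wd_cochain (u n). Proof. by case: (cu n). Qed.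
Let ccu n : cocycle (u n). Proof. by case: (cu n). Qed.

Lemma Psi_small n (s : 'rV[RR]_n.+1 -> X) : singular s ->
  exists2 e : RR, 0 < e & forall m x, std_simplex n x ->
    {in m, forall y, std_simplex n y /\ `|x - y| <= e} -> Psi s u m = 0.
Proof.
move=> ss; have [e e0 he] := lebesgue_number ss oV oW VW.
exists e => // m x Cx Cm; rewrite /Psi; case E : (size m) => [//|p].
have Cm' : {in m, forall y, std_simplex n y} by move=> y /Cm[].
have xm : {in m, forall y, `|x - y| <= e} by move=> y /Cm[].
case: (he _ Cx) => hx; [apply: uV|apply: uW]; try exact: singular_aff.
- by move=> y sy /=; apply: hx; [exact: aff_simplex|exact: norm_aff_le].
- by move=> y sy /=; apply: hx; [exact: aff_simplex|exact: norm_aff_le].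
Qed.

(** The value on [l] of the cochain $cTS^i$, where $c$ is [u] on the affine simplices in the domain
    of [s]. *)
Let H n (s : 'rV[RR]_n.+1 -> X) l i := iter i (Sd n.+1) (Td n.+1 (Psi s u)) l.

Let H_small n (s : 'rV[RR]_n.+1 -> X) : singular s ->
  \forall i \near \oo, H s (verts n) i = 0.
Proof.
move=> ss; have [e e0 he] := Psi_small ss; rewrite /H.
apply: (iter_Sd_small _ (size_verts n) (@verts_simplex n) e0).
  exact: bary_closed_simplex.
move=> m x mn Cx Cm; rewrite -(@Td0 K _ n.+1 m).
(* [Td] evaluates only on lists whose vertices stay in the ball about [x], where [Psi s u] is 0. *)
apply: (eq_Td (C := std_simplex n `&` [set y | `|x - y| <= e])) => //.
  by apply: bary_closedI; [exact: bary_closed_simplex|exact: bary_closed_ball].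
by move=> m' _ Cm'; exact: (he _ x).
Qed.

Let Sd_small n (s : 'rV[RR]_n.+1 -> X) : singular s ->
  \forall i \near \oo, iter i (Sd n.+1) (Psi s u) (verts n) = 0.
Proof.
move=> ss; have [e e0 he] := Psi_small ss.
apply: (iter_Sd_small _ (size_verts n) (@verts_simplex n) e0).
  exact: bary_closed_simplex.
by move=> m x _; exact: he.
Qed.

(** By naturality along the affine map onto the face, restricting [s] amounts to evaluating on the
    vertices of that face; the coboundary of the primitive thus becomes [dseq]. *)
Let H_face n (s : 'rV[RR]_n.+2 -> X) (j : 'I_n.+2) i :
  H (s \o face j) (verts n) i =
  iter i (Sd n.+1) (Td n.+1 (Psi s u)) (del j (verts n.+1)).
Proof.
set l := del j (verts n.+1).
have ln : size l = n.+1.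
  by apply: succn_inj; rewrite size_del size_verts.
have -> : s \o face j = s \o aff (p := n) l.
  by apply/funext => x /=; rewrite aff_face.
rewrite /H (_ : Psi _ u = Psi s u \o map (aff (p := n) l)); last first.
  by apply/funext => m; rewrite Psi_aff.
rewrite (funext (Td_map _ _ _)).
rewrite (_ : (fun m => _) = Td n.+1 (Psi s u) \o map (aff (p := n) l))//.
by rewrite iter_Sd_map map_aff_verts.
Qed.

Lemma small_simplices n : cohomologous (u n) (gzero K X n).
Proof.
case: n => [|n].
  (* A 0-simplex is a point, hence lies in [V] or in [W]. *)
  move=> s ss; rewrite /gzero.
  pose z : 'rV[RR]_1 := delta_mx ord0 ord0.
  have zE x : std_simplex 0 x -> x = z.
    move=> [_]; rewrite big_ord1 => x1.
    by apply/rowP => i; rewrite ord1 mxE !eqxx x1.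
  have : (V `|` W) (s z) by rewrite VW.
  by move=> [zV|zW]; [apply: uV|apply: uW] => // x /zE ->.
(* The primitive $\sum_i cTS^i$; the sum is finite on each singular simplex. *)
exists (fun s => finsum (H s (verts n))); split.
  move=> s t ss st stE; congr finsum; apply/funext => i.
  (* Any bound [d] serves here, since the functionals agree on all lists in the simplex. *)
  have [d _ ld] := pairwise_le_bounded (verts n).
  apply: (eq_iter_Sd (N := n) (C := std_simplex n) _ _ _ _ ld) => //.
  - exact: size_verts.
  - exact: bary_closed_simplex.
  - exact: verts_simplex.
  move=> m mn Cm _; apply: (eq_Td mn (bary_closed_simplex (N := n)) Cm).
  by move=> m' _ Cm'; exact: eq_Psi.
move=> s ss; rewrite /gzero subr0.
have /choice[M hM] : forall j : 'I_n.+2, exists M, forall i, (M <= i)%N ->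
    H (s \o face j) (verts n) i = 0.
  by move=> j; have [M _ hM] := H_small (singular_face (j := j) ss); exists M.
have [M0 _ hM0] := Sd_small ss.
(* One bound for all faces and for the subdivisions of the whole simplex. *)
pose M' := (M0 + \sum_j M j)%N.
rewrite /cobound (eq_bigr (fun j : 'I_n.+2 => (-1) ^+ j * \sum_(i < M')
    iter i (Sd n.+1) (Td n.+1 (Psi s u)) (del j (verts n.+1)))); last first.
  move=> j _; rewrite (@finsumE _ _ M').
    by under eq_bigr do rewrite H_face.
  move=> i iM; apply: hM; apply: leq_trans iM.
  by rewrite /M' (bigD1 j)//= addnCA leq_addr.
transitivity (dseq (fun m => \sum_(i < M') iter i (Sd n.+1) (Td n.+1 (Psi s u)) m)
    (verts n.+1)); last by rewrite dseqE size_verts.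
rewrite (dseq_sum M' (fun i m => iter i (Sd n.+1) (Td n.+1 (Psi s u)) m)).
rewrite (eq_bigr (fun i : 'I_M' => iter i (Sd n.+2) (Psi s u) (verts n.+1) -
   iter i.+1 (Sd n.+2) (Psi s u) (verts n.+1))); last first.
  move=> i _; apply: (@dseq_iter_Td _ _ n.+1 _ _ _ _ (std_simplex n.+1)) => //.
  - exact: size_verts.
  - exact: bary_closed_simplex.
  - exact: verts_simplex.
  - by move=> m _ Cm; apply: Psi_cocycle.
rewrite -(big_mkord xpredT (fun i => iter i (Sd n.+2) (Psi s u) (verts n.+1) -
   iter i.+1 (Sd n.+2) (Psi s u) (verts n.+1))).
(* The sum telescopes to the value of [u] on [s] minus that on the [M']-th subdivision, which is
   0. *)
under eq_bigr do rewrite -opprB.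
rewrite sumrN telescope_sumr// opprB [X in _ - X]hM0 ?subr0 /= ?Psi_verts//.
exact: leq_addr.
Qed.

End SmallSimplices.

(** * Cup products of classes vanishing on the members of a cover *)

Lemma singular_comp (X Y : topologicalType) n (s : 'rV[RR]_n.+1 -> X) (h : X -> Y) :
  continuous h -> singular s -> singular (h \o s).
Proof. by move=> hc ss; apply: within_continuous_comp. Qed.

Lemma singular_lift (X : topologicalType) (V : set X) n (s : 'rV[RR]_n.+1 -> X) :
  singular s -> (forall x, std_simplex n x -> V (s x)) ->
  exists t : 'rV[RR]_n.+1 -> V, singular t /\
    forall x, std_simplex n x -> set_val (t x) = s x.
Proof.
move=> ss sV.
(* A default value where [s] leaves [V], available since [V] contains the image of a vertex. *)
have v0 : V.
  exists (s ((verts n)`_0)); apply/mem_set/sV/verts_simplex/mem_nth.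
  by rewrite size_verts.
pose t x : V := if pselect (V (s x)) is left Vx then exist _ (s x) (mem_set Vx)
  else v0.
have tE x : std_simplex n x -> set_val (t x) = s x.
  by move=> sx; rewrite /t; case: pselect => // /(_ (sV _ sx)).
exists t; split => //; apply: continuous_comp_initial.
apply: (@subspace_eq_continuous _ _ _ s) ss => x /set_mem sx.
by rewrite -tE.
Qed.

Section CupVanish.
Variables (K : comPzRingType) (X : topologicalType).
Implicit Types u v : gcochain K X.

(** The primitive on [V] is applied to lifts of simplices lying in [V] and extended by 0 to the
    others; faces of a simplex in [V] lie in [V], so its coboundary is still [u] there. *)
Lemma extend_primitive u (V : set X) : (forall n, wd_cochain (u n)) ->
  gcohom (pullback (set_val : V -> X) u) (gzero K V) ->
  exists2 w : gcochain K X, forall n, wd_cochain (w n) &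
    forall n s, @singular X n s -> (forall x, std_simplex n x -> V (s x)) ->
      u n s = gcobound w n s.
Proof.
move=> wu uV.
pose th n := projT1 (cid (uV n.+1)).
have [wth thE] : (forall n, wd_cochain (th n)) /\ forall n (t : 'rV[RR]_n.+2 -> V),
    singular t -> u n.+1 (set_val \o t) = cobound (th n) t.
  split=> n; have [w1 w2] := projT2 (cid (uV n.+1)); first exact: w1.
  by move=> t st; rewrite -w2// /gzero subr0.
have sv : continuous (set_val : V -> X) by exact: initial_continuous.
pose lift n (s : 'rV[RR]_n.+1 -> X) (t : 'rV[RR]_n.+1 -> V) := singular t /\
    forall x, std_simplex n x -> set_val (t x) = s x.
pose w n (s : 'rV[RR]_n.+1 -> X) : K :=
  if pselect (exists t, lift n s t) is left e then th n (projT1 (cid e)) else 0.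
(* Independence of the chosen lift: two lifts agree on the simplex, as [set_val] is injective, and
   [th n] is well defined. *)
have wE n s t : lift n s t -> w n s = th n t.
  move=> [ts tE]; rewrite /w; case: pselect => [e|[]]; last by exists t.
  case: cid => /= t' [t's t'E]; apply: wth => // x /set_mem sx.
  by apply: val_inj; rewrite -!set_valE tE// t'E.
exists w.
  move=> n s t ss st stE.
  have [[l sl]|nl] := pselect (exists l, lift n s l).
    rewrite (wE _ _ _ sl) (wE _ t l)//; case: sl => ls lE; split => // x sx.
    by rewrite lE// stE//; exact/mem_set.
  rewrite /w; case: pselect => // _; case: pselect => // -[l [ls lE]].
  exfalso; apply: nl; exists l; split => // x sx.
  by rewrite lE// stE//; exact/mem_set.
move=> [|n] s ss sV; have [t [ts tE]] := singular_lift ss sV.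
  (* In degree 0, cohomologous to zero means equal to zero, and [gcobound w] is 0 there. *)
  rewrite -[RHS](uV 0%N t ts) /pullback; apply: wu => //.
    exact: singular_comp.
  by move=> x /set_mem sx /=; rewrite tE.
rewrite (wu _ s (set_val \o t))//; last 2 first.
- exact: singular_comp.
- by move=> x /set_mem sx /=; rewrite tE.
rewrite thE//; apply: eq_bigr => j _; congr (_ * _); apply/esym/wE; split.
  exact: singular_face.
by move=> x sx /=; rewrite tE//; exact: face_simplex.
Qed.

Lemma cohomologousD n (c c' d : cochain K X n) : cohomologous c (gzero K X n) ->
  (forall s, singular s -> d s = c s + c' s) -> cohomologous c' (gzero K X n) ->
  cohomologous d (gzero K X n).
Proof.
case: n c c' d => [|n] c c' d /=.
  by move=> c0 dE c'0 s ss; rewrite dE// c0// c'0// /gzero addr0.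
move=> [a [wa ca]] dE [b [wb cb]]; exists (fun s => a s + b s); split.
  by move=> s t ss st stE; rewrite (wa s t)// (wb s t).
move=> s ss; rewrite /cobound; under eq_bigr do rewrite mulrDr.
rewrite big_split /= -[X in _ = X + _]/(cobound a s) -[X in _ = _ + X]/(cobound b s).
by rewrite -ca// -cb// dE// /gzero !subr0.
Qed.

Lemma cohomologous_gcobound w n : (forall n, wd_cochain (w n)) ->
  cohomologous (gcobound w n) (gzero K X n).
Proof.
case: n => [|n] ww /=; first by [].
by exists (w n); split => // s ss; rewrite /gzero subr0.
Qed.

Lemma gcocycleB u w : gcocycle u -> (forall n, wd_cochain (w n)) ->
  gcocycle (fun n s => u n s - gcobound w n s).
Proof.
move=> cu ww n; have [wu cun] := cu n; split.
  by move=> s t ss st stE; rewrite (wu s t)// (wd_gcobound ww ss st).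
move=> s ss; rewrite /cobound; under eq_bigr do rewrite mulrBr.
rewrite sumrB -[X in X - _]/(cobound (u n) s) cun// sub0r.
by have [_ /(_ s ss)] := gcocycle_gcobound ww n; rewrite /cobound => ->; rewrite oppr0.
Qed.

Lemma Psi_vanish u n (V : set X) (s : 'rV[RR]_n.+1 -> X) l :
  (forall n s, @singular X n s -> (forall x, std_simplex n x -> V (s x)) -> u n s = 0) ->
  singular s -> (forall x, std_simplex n x -> V (s x)) ->
  {in l, forall z, std_simplex n z} -> Psi s u l = 0.
Proof.
move=> uV ss sV ls; rewrite /Psi; case E : (size l) => [//|p].
apply: uV; first exact: singular_aff.
by move=> x sx /=; apply/sV/aff_simplex.
Qed.

Lemma gcup_vanish u v (V W : set X) : gcocycle u -> gcocycle v ->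
  open V -> open W -> V `|` W = setT ->
  gcohom (pullback (set_val : V -> X) u) (gzero K V) ->
  gcohom (pullback (set_val : W -> X) v) (gzero K W) ->
  gcohom (gcup u v) (gzero K X).
Proof.
move=> cu cv oV oW VW uV vW n.
have wu m : wd_cochain (u m) by case: (cu m).
have wv m : wd_cochain (v m) by case: (cv m).
have ccv m : cocycle (v m) by case: (cv m).
have [a wa aE] := extend_primitive wu uV.
have [b wb bE] := extend_primitive wv vW.
pose u' : gcochain K X := fun n s => u n s - gcobound a n s.
pose v' : gcochain K X := fun n s => v n s - gcobound b n s.
have cu' : gcocycle u' by exact: gcocycleB.
have cv' : gcocycle v' by exact: gcocycleB.
have u'V m s : @singular X m s -> (forall x, std_simplex m x -> V (s x)) ->
    u' m s = 0.
  by move=> ss sV; rewrite /u' aE// subrr.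
have v'W m s : @singular X m s -> (forall x, std_simplex m x -> W (s x)) ->
    v' m s = 0.
  by move=> ss sW; rewrite /v' bE// subrr.
have wu' m : wd_cochain (gbar u' m).
  move=> s t ss st stE; rewrite /gbar; have [wu'm _] := cu' m.
  by rewrite (wu'm s t).
have small : cohomologous (gcup u' v' n) (gzero K X n).
  apply: (small_simplices (gcocycle_gcup cu' cv') oV oW VW) => m s ss sI.
    rewrite -Psi_verts Psi_gcup (@eq_cupseq _ _ _ (fun=> 0) _ (Psi s v')) ?cupseq0l//.
    move=> l ml _; apply: (Psi_vanish u'V ss sI) => z /ml; exact: verts_simplex.
  rewrite -Psi_verts Psi_gcup (@eq_cupseq _ _ _ (Psi s u') _ (fun=> 0)) ?cupseq0r//.
  move=> l ml _; apply: (Psi_vanish v'W ss sI) => z /ml; exact: verts_simplex.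
(* The decomposition is $uv = u'v' + d(av) + d(\bar u'b)$ with $d(av) = (da)v$ and $d(\bar u'b) =
   u'(db)$, where $\bar u'$ is [gbar u']. *)
have h1 : cohomologous (gcobound (gcup a v) n) (gzero K X n).
  by apply: cohomologous_gcobound => m; exact: wd_gcup.
have h2 : cohomologous (gcobound (gcup (gbar u') b) n) (gzero K X n).
  by apply: cohomologous_gcobound => m; exact: wd_gcup.
have h := cohomologousD small (fun s _ => erefl) h1.
apply: (cohomologousD h _ h2) => s ss.
rewrite gcobound_gcupl// gcobound_gcupr//; last by move=> m; case: (cu' m).
rewrite /gcup -!big_split /=; apply: eq_bigr => p _; rewrite /u' /v'; ring.
Qed.

End CupVanish.

(** * Homotopy weight *)

(* Unlike in [hdist_cover], there are [m] open sets and not [m + 1]. *)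
Definition hcover (X Y : topologicalType) (f g : X -> Y) (m : nat) :=
  exists U : 'I_m -> set X,
    (forall j, open (U j)) /\ (\bigcup_j U j = setT) /\
    (forall j, homotopic_on (U j) f g).

Lemma hdist_leP (X Y : topologicalType) (f g : X -> Y) (k : nat) :
  (hdist f g <= k%:R%:E)%E <-> hcover f g k.+1.
Proof.
split=> [fgk|fgk]; last by apply: ereal_inf_lbound; exists k.
(* The distance is an infimum of integers, so the strict bound [k + 1] yields a cover with
   [n <= k]. *)
have /ereal_inf_lt[_ [n [U [oU [cU hU]]] <-]] : (hdist f g < k.+1%:R%:E)%E.
  by rewrite (le_lt_trans fgk)// lte_fin ltr_nat.
rewrite lte_fin ltr_nat ltnS => nk.
(* The cover is padded by repetition: [inord] sends the surplus indices to 0. *)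
exists (fun j => U (inord j)); split; [by move=> j|split; last by move=> j].
rewrite -subTset -cU => x [j _ Ux].
by exists (widen_ord (nk : (n.+1 <= k.+1)%N) j) => //=; rewrite inord_val.
Qed.

Lemma homotopic_on_comp (A X Y : topologicalType) (h : A -> X) (U : set X)
    (f g : X -> Y) :
  continuous h -> homotopic_on U f g -> homotopic_on (h @^-1` U) (f \o h) (g \o h).
Proof.
move=> hc [H [Hc HE]]; exists (H \o (fun z => (h z.1, z.2))); split.
  have hx : continuous (fun z : A * RR => (h z.1, z.2)).
    move=> z; have h1 : (fun w : A * RR => h w.1) @ z --> h z.1.
      by apply: (@cvg_comp _ _ _ fst h); [exact: cvg_fst|exact: hc].
    have h2 : (snd : A * RR -> RR) @ z --> z.2 by exact: cvg_snd.
    exact: (cvg_pair h1 h2).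
  by apply: continuous_within_comp Hc hx _ => -[x t] [].
by move=> x /= Ux; exact: HE.
Qed.

Lemma hcover_comp (A X Y : topologicalType) (h : A -> X) (f g : X -> Y) m
    (U : 'I_m -> set X) :
  continuous h -> (forall j, open (U j)) -> (forall j, homotopic_on (U j) f g) ->
  (forall x, exists j, U j (h x)) -> hcover (f \o h) (g \o h) m.
Proof.
move=> hc oU hU cU; exists (fun j => h @^-1` U j); split => [j|].
  by apply: open_comp => // x _; exact: hc.
split=> [|j]; last exact: homotopic_on_comp.
by rewrite -subTset => x _; have [j Uj] := cU x; exists j.
Qed.

Section Weight.
Variables (K : comPzRingType) (X Y : topologicalType) (f g : X -> Y).
Implicit Types u v : gcochain K X.

(** Counts open sets, so [m] is [k + 1] in terms of the distance, and joining covers adds the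
    indices. *)
Definition hvanish u (m : nat) :=
  forall (A : topologicalType) (phi : A -> X), continuous phi ->
    hcover (f \o phi) (g \o phi) m -> gcohom (pullback phi u) (gzero K A).

Lemma hvanishS u k : hvanish u k.+1 <-> hw_prop f g u k.
Proof.
by split=> h A phi phic; move=> /hdist_leP; exact: h.
Qed.

Lemma hvanish0 u : hvanish u 0.
Proof.
move=> A phi _ [U [_ [UT _]]].
have A0 (x : A) : False.
  by have : setT x by []; rewrite -UT => -[[]].
case=> [s _|n /=]; first by case: (A0 (s 0)).
exists (fun=> 0); split => [//|s]; by case: (A0 (s 0)).
Qed.

Lemma hwE u : hw f g u = ereal_sup [set m%:R%:E | m in hvanish u].
Proof.
rewrite /hw; congr ereal_sup; apply/seteqP; split => x /=.
  by move=> [->|[k /hvanishS uk <-]]; [exists 0%N => //; exact: hvanish0|exists k.+1].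
by move=> [[|k] uk <-]; [left|right; exists k => //; exact/hvanishS].
Qed.

Lemma gcocycle_pullback (A : topologicalType) (phi : A -> X) u : continuous phi ->
  gcocycle u -> gcocycle (pullback phi u).
Proof.
move=> phic cu n; have [wu cun] := cu n; split => [s t ss st stE|s ss].
  apply: wu; [exact: singular_comp|exact: singular_comp|].
  by move=> x sx /=; rewrite stE.
by rewrite -[LHS]/(cobound (u n) (phi \o s)) cun//; exact: singular_comp.
Qed.

(** The weight is tested on all spaces over [X], among them the open subspace [V] of [A]. *)
Lemma hvanish_bigcup (A : topologicalType) (phi : A -> X) u m (U : 'I_m -> set A)
    (V := \bigcup_i U i) :
  hvanish u m -> continuous phi -> (forall j, open (U j)) ->
  (forall j, homotopic_on (U j) (f \o phi) (g \o phi)) ->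
  gcohom (pullback (set_val : V -> A) (pullback phi u)) (gzero K V).
Proof.
move=> um phic oU hU; apply: (um V (phi \o set_val)).
  by move=> x; apply: continuous_comp; [exact: initial_continuous|exact: phic].
apply: (@hcover_comp V A Y set_val (f \o phi) (g \o phi) m U) => // [|x].
  exact: initial_continuous.
by have [i _ Ui] := set_mem (valP x); exists i.
Qed.

Lemma hvanishD u v a b : gcocycle u -> gcocycle v -> hvanish u a -> hvanish v b ->
  hvanish (gcup u v) (a + b).
Proof.
move=> cu cv ua vb A phi phic [U [oU [cU hU]]].
apply: (@gcup_vanish _ _ (pullback phi u) (pullback phi v)
  (\bigcup_i U (lshift b i)) (\bigcup_i U (rshift a i))).
- exact: gcocycle_pullback.
- exact: gcocycle_pullback.
- by apply: bigcup_open => i _.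
- by apply: bigcup_open => i _.
- rewrite -subTset -cU => x [j _].
  by case: (split_ordP j) => i -> Ux; [left|right]; exists i.
- exact: hvanish_bigcup.
- exact: hvanish_bigcup.
Qed.

Lemma hw_ge0 u : (0 <= hw f g u)%E.
Proof. by rewrite hwE; apply: ereal_sup_ubound; exists 0%N => //; exact: hvanish0. Qed.

Lemma hw_gcup u v : gcocycle u -> gcocycle v ->
  (hw f g u + hw f g v <= hw f g (gcup u v))%E.
Proof.
move=> cu cv.
have le a b : hvanish u a -> hvanish v b ->
    (a%:R%:E + b%:R%:E <= hw f g (gcup u v))%E.
  move=> ua vb; rewrite [leRHS]hwE; apply: ereal_sup_ubound.
  by exists (a + b)%N; [exact: hvanishD|rewrite natrD].
(* An infinite right side is trivial; with a finite one, terms can be moved across the inequality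
   and the suprema taken in one factor at a time. *)
have [->|fin] := eqVneq (hw f g (gcup u v)) +oo%E; first exact: leey.
have w_fin : hw f g (gcup u v) \is a fin_num.
  by rewrite ge0_fin_numE ?hw_ge0// lt_neqAle fin leey.
have v_le a : hvanish u a -> (hw f g v <= hw f g (gcup u v) - a%:R%:E)%E.
  move=> ua; rewrite [leLHS]hwE; apply: ge_ereal_sup => _ [b vb <-].
  by rewrite leeBrDr// addeC le.
(* Taking [a = 0] bounds the weight of [v], so that it can be subtracted as well. *)
have v_fin : hw f g v \is a fin_num.
  rewrite ge0_fin_numE ?hw_ge0//; apply: le_lt_trans (v_le 0%N (hvanish0 u)) _.
  by rewrite sube0 lt_neqAle fin leey.
rewrite -leeBrDr// [leLHS]hwE; apply: ge_ereal_sup => _ [a ua <-].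
by rewrite leeBrDr// addeC -leeBrDr// v_le.
Qed.

Lemma gcocycle_gcup_iter k (u : nat -> gcochain K X) :
  (forall j, (j <= k)%N -> gcocycle (u j)) -> gcocycle (gcup_iter k u).
Proof.
elim: k => [|k IH] cu; first exact: cu.
apply: gcocycle_gcup; last exact: cu.
by apply: IH => j jk; apply: cu; exact: leqW.
Qed.

End Weight.

Theorem theorem5p9 (K : comPzRingType) (X Y : topologicalType) (f g : X -> Y)
  (k : nat) (u : nat -> gcochain K X) :
  continuous f -> continuous g ->
  (forall j, (j <= k)%N -> in_J f g (u j)) ->
  (\sum_(j < k.+1) hw f g (u j) <= hw f g (gcup_iter k u))%E.
Proof.
move=> _ _ uJ.
have cu j : (j <= k)%N -> gcocycle (u j) by move=> /uJ[[]].
elim: k {uJ} cu => [|k IH] cu; first by rewrite big_ord1.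
rewrite big_ord_recr /=; apply: le_trans (leeD (IH _) (lexx _)) _.
  by move=> j jk; apply: cu; exact: leqW.
apply: hw_gcup; last exact: cu.
by apply: gcocycle_gcup_iter => j jk; apply: cu; exact: leqW.
Qed.
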